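(* Let $(X,\tau)$ be a path connected topological space. Then $(X,{}^{*}O(X))$ is a path connected space.
   Context: For a topological space $(X,\tau)$, a set $U\subseteq X$ is called regular open if $\mathrm{int}(\mathrm{cl}(U))=U$; the collection of all regular open subsets is denoted $R.O(X)$. A set $A\subseteq X$ is called $*$-open if for every $x\in A$ there exists $U\in R.O(X)$ with $x\in U\subseteq A$. The collection of all $*$-open subsets of $(X,\tau)$ is denoted ${}^{*}O(X)$; it is a topology on $X$. *)

(* Defs.v *)
From HB Require Import structures.
From mathcomp Require Import all_boot all_order all_algebra.
From mathcomp Require Import all_classical all_reals all_analysis.
From mathcomp Require Import homotopy.
Import Order.TTheory GRing.Theory Num.Theory numFieldNormedType.Exports.

Set Implicit Arguments.
Unset Strict Implicit.
Unset Printing Implicit Defensive.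

Local Open Scope classical_set_scope.
Local Open Scope ring_scope.

Definition star_open (T : topologicalType) (A : set T) : Prop :=
  forall x, A x -> exists U : set T, [/\ regopen U, U x & U `<=` A].

Lemma regopen_open (T : topologicalType) (U : set T) : regopen U -> open U.
Proof. by move=> <-; exact: open_interior. Qed.

Lemma regopenI (T : topologicalType) (U V : set T) :
  regopen U -> regopen V -> regopen (U `&` V).
Proof.
move=> rU rV; apply/seteqP; split=> [x xUV|].
  split; [rewrite -rU|rewrite -rV]; move: xUV; apply: filterS.
    by apply: closureS => ? [].
  by apply: closureS => ? [].
rewrite -open_subsetE; first exact: subset_closure.
by apply: openI; exact: regopen_open.
Qed.

(* The alias lets the carrier of T bear the star_open topology instead. *)
Definition star_space (T : topologicalType) : Type := T.

Section star_topology.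
Context (T : topologicalType).

HB.instance Definition _ := Choice.on (star_space T).

Let star_openT : star_open [set: T].
Proof.
move=> x _; exists setT; split => //; rewrite /regopen.
by rewrite closureT interiorT.
Qed.

Let star_openI : setI_closed (@star_open T).
Proof.
move=> A B oA oB x [/oA[U [rU Ux UA]] /oB[V [rV Vx VB]]].
by exists (U `&` V); split; [exact: regopenI | | exact: setISS].
Qed.

Let star_open_bigU (I : Type) (f : I -> set T) :
  (forall i, star_open (f i)) -> star_open (\bigcup_i f i).
Proof.
move=> of_ x [i _ /of_[U [rU Ux Uf]]]; exists U; split => //.
by move=> y /Uf fy; exists i.
Qed.

HB.instance Definition _ := isOpenTopological.Build (star_space T)
  star_openT star_openI star_open_bigU.

Lemma star_spaceE : @open (star_space T) = @star_open T.
Proof. by []. Qed.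

End star_topology.

Definition unit_interval (R : realType) : Type := set_type `[0 : R, 1]%classic.

Section unit_interval.
Context (R : realType).

HB.instance Definition _ := Topological.on (unit_interval R).

Let mem0 : (0 : R) \in `[0 : R, 1]%classic.
Proof. by apply/mem_set; rewrite /= in_itv /= lexx ler01. Qed.

Let mem1 : (1 : R) \in `[0 : R, 1]%classic.
Proof. by apply/mem_set; rewrite /= in_itv /= lexx ler01. Qed.

Definition unit_interval0 : unit_interval R := exist _ 0 mem0.
Definition unit_interval1 : unit_interval R := exist _ 1 mem1.

Let unit_interval01 : unit_interval0 != unit_interval1.
Proof. by apply/eqP => -[] /eqP; rewrite eq_sym oner_eq0. Qed.

HB.instance Definition _ :=
  isBiPointed.Build (unit_interval R) unit_interval01.

End unit_interval.

(* The empty space counts as path connected. *)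
Definition path_connected (R : realType) (T : topologicalType) : Prop :=
  forall x y : T, inhabited {path unit_interval R from x to y in T}.

(* Main.v *)
From HB Require Import structures.
Require Import Defs.
From mathcomp Require Import all_boot all_classical all_reals all_analysis.
From mathcomp Require Import homotopy.

(** Regular open sets are open, so the star topology is coarser than the original one and the
    identity [T -> star_space T] is continuous. Composing a path with it gives a path in the star
    topology. *)

Lemma star_open_open (T : topologicalType) (A : set T) : star_open A -> open A.
Proof.
move=> oA; rewrite openE => x /oA[U [rU Ux UA]].
by apply: filterS UA _; apply: open_nbhs_nbhs; split => //; exact: regopen_open.
Qed.

(** The identity gets a name so that a continuity instance can be attached to it. *)
Definition to_star_space (T : topologicalType) : T -> star_space T := id.

Lemma to_star_space_continuous (T : topologicalType) :
  continuous (@to_star_space T).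
Proof. by apply/continuousP => A; exact: star_open_open. Qed.

HB.instance Definition _ (T : topologicalType) :=
  isContinuous.Build _ _ _ (@to_star_space_continuous T).

Theorem lemma20 (R : realType) (X : topologicalType) (hX : path_connected R X) :
  path_connected R (star_space X).
Proof.
move=> x y; have [f] := hX x y.
(* The endpoints [to_star_space X x] and [to_star_space X y] are convertible to [x] and [y]. *)
exact: (inhabits (@to_star_space X \o f :
  {path unit_interval R from to_star_space X x to to_star_space X y})).
Qed.
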